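(* Suppose a quadratic harness $(X_t)_{t>0}$ with parameters $q,\eta,\theta,\sigma,\tau$ has finite moments of all orders, and $(q,\sigma\tau)\ne(-1,1)$. Suppose that real sequences $(\alpha_n)_{n\ge1},(\beta_n)_{n\ge1},(\gamma_n)_{n\ge0},(\delta_n)_{n\ge0},(\varepsilon_n)_{n\ge1},(\varphi_n)_{n\ge1}$ satisfy the initial conditions $$\alpha_1=0,\ \beta_1=1,\ \gamma_0=\delta_0=0,\ \varepsilon_1=1,\ \varphi_1=0,$$ and the following equations, where (b) holds for all $n\ge0$ and (a), (c), (d), (e) hold for all $n\ge1$: (a) $\sigma^2\tau\alpha_n\alpha_{n+1}+\sigma q\,\alpha_n\beta_{n+1}+\sigma\beta_n\beta_{n+1}=\sigma\alpha_{n+1}\beta_n$; (b) $\beta_{n+1}\gamma_{n+1}+\sigma\alpha_{n+1}\delta_n=\sigma\tau\alpha_{n+1}(\gamma_n+\gamma_{n+1})+q(\sigma\alpha_{n+1}\delta_{n+1}+\beta_{n+1}\gamma_n)+\sigma\beta_{n+1}(\delta_n+\delta_{n+1})+\sigma\alpha_{n+1}\theta+\beta_{n+1}\eta$; (c) $\beta_{n+1}\varepsilon_{n+1}+\gamma_n\delta_n+\sigma\alpha_n\varphi_n=\tau(\sigma\alpha_{n+1}\varepsilon_{n+1}+\gamma_n^2+\sigma\alpha_n\varepsilon_n)+q(\sigma\alpha_{n+1}\varphi_{n+1}+\gamma_n\delta_n+\beta_n\varepsilon_n)+\sigma(\beta_{n+1}\varphi_{n+1}+\delta_n^2+\beta_n\varphi_n)+\gamma_n\theta+\delta_n\eta+1$;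 (d) $\gamma_{n-1}\varphi_n+\delta_n\varepsilon_n=\tau(\gamma_{n-1}+\gamma_n)\varepsilon_n+q(\gamma_n\varphi_n+\delta_{n-1}\varepsilon_n)+\sigma(\delta_{n-1}+\delta_n)\varphi_n+\varepsilon_n\theta+\varphi_n\eta$; (e) $\varepsilon_n\varphi_{n+1}=\tau\varepsilon_n\varepsilon_{n+1}+q\,\varepsilon_{n+1}\varphi_n+\sigma\varphi_n\varphi_{n+1}$. Put $a_n(t)=\sigma\alpha_{n+1}t+\beta_{n+1}$ and $b_n(t)=\gamma_nt+\delta_n$ for $n\ge0$, and $c_n(t)=\varepsilon_nt+\varphi_n$ for $n\ge1$, and suppose $a_n(t)\ne0$ for all $t\ge0$, $n\ge0$. Let $\{p_n(x;t):n\ge0,t>0\}$ satisfy $$x\,p_n(x;t)=a_n(t)p_{n+1}(x;t)+b_n(t)p_n(x;t)+c_n(t)p_{n-1}(x;t),\qquad n\ge0,$$ with $p_{-1}(x;t)=0$, $p_0(x;t)=1$, $p_1(x;t)=x$. Then $\{p_n(x;t)\}$ are orthogonal martingale polynomials for $(X_t)$.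
   Context: Equalities between conditional expectations hold almost surely. $(X_t)_{t>0}$ is a separable square-integrable real process; $\mathcal F_{s,u}=\sigma\{X_t:t\in(0,s]\cup[u,\infty)\}$, $\mathcal F_{\le s}=\sigma\{X_t:0<t\le s\}$; $\mathrm{Var}[X\mid\mathcal F]=\mathbb{E}[X^2\mid\mathcal F]-(\mathbb{E}[X\mid\mathcal F])^2$; $\Delta_{s,u}=\frac{X_u-X_s}{u-s}$, $\widetilde\Delta_{s,u}=\frac{uX_s-sX_u}{u-s}$. For real $\eta,\theta$, $\sigma,\tau\ge0$ and $q\le 1+2\sqrt{\sigma\tau}$, $(X_t)$ is a quadratic harness with parameters $q,\eta,\theta,\sigma,\tau$ if $\mathbb{E}(X_t)=0$, $\mathbb{E}(X_sX_t)=\min\{s,t\}$ for all $s,t>0$, and for all $0<s<t<u$ $$\mathbb{E}[X_t\mid\mathcal F_{s,u}]=\tfrac{u-t}{u-s}X_s+\tfrac{t-s}{u-s}X_u,$$ $$\mathrm{Var}[X_t\mid\mathcal F_{s,u}]=\tfrac{(u-t)(t-s)}{u(1+\sigma s)+\tau-qs}\Big(1+\eta\widetilde\Delta_{s,u}+\theta\Delta_{s,u}+\sigma\widetilde\Delta_{s,u}^2+\tau\Delta_{s,u}^2-(1-q)\Delta_{s,u}\widetilde\Delta_{s,u}\Big).$$ Orthogonal martingale polynomials for $(X_t)$: polynomials $p_n(x;t)$ in $x$ of degree $n$ with $\mathbb{E}[p_n(X_t;t)\mid\mathcal F_{\le s}]=p_n(X_s;s)$ for all $0<s<t$, $n\ge0$,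 and $\mathbb{E}(p_n(X_t;t)p_m(X_t;t))=0$ for all $t>0$, $n\ne m$. *)

(* Defs.v *)
From HB Require Import structures.
From mathcomp Require Import all_boot all_order all_algebra.
From mathcomp Require Import all_classical all_reals all_analysis.

Set Implicit Arguments.
Unset Strict Implicit.
Unset Printing Implicit Defensive.

Import Order.TTheory GRing.Theory Num.Theory.
Import numFieldNormedType.Exports.

Local Open Scope classical_set_scope.
Local Open Scope ring_scope.

(* A process on (0, +oo) is encoded as a family of random variables indexed by
   the whole of R; every notion below only looks at the indices t > 0. *)

Section conditioning.
Context (d : measure_display) (T : measurableType d) (R : realType)
        (P : probability T R).

Definition sigma_process (X : R -> {RV P >-> R}) (I : set R) : set (set T) :=
  <<s \bigcup_(t in I) preimage_set_system setT (X t) measurable >>.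

Definition sigma_past (X : R -> {RV P >-> R}) (s : R) : set (set T) :=
  sigma_process X [set t | 0 < t <= s].

Definition sigma_past_future (X : R -> {RV P >-> R}) (s u : R) :
    set (set T) :=
  sigma_process X ([set t | 0 < t <= s] `|` [set t | u <= t]).

Record condexp_version (G : set (set T)) (f g : T -> R) : Prop := {
  condexp_dom : f \in Lfun P 1;
  condexp_int : g \in Lfun P 1;
  condexp_meas : forall B : set R, measurable B -> G (g @^-1` B);
  condexp_avg : forall A, G A ->
    (\int[P]_(w in A) (g w)%:E = \int[P]_(w in A) (f w)%:E)%E }.

(* E[f | G] = g almost surely *)
Definition condexp_eq (G : set (set T)) (f g : T -> R) : Prop :=
  exists2 h, condexp_version G f h & {ae P, forall w, h w = g w}.

(* Var[f | G] = g almost surely, with Var[f | G] = E[f^2 | G] - E[f | G]^2 *)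
Definition condvar_eq (G : set (set T)) (f g : T -> R) : Prop :=
  exists m1 m2, [/\ condexp_version G f m1,
    condexp_version G (fun w => f w ^+ 2) m2 &
    {ae P, forall w, m2 w - m1 w ^+ 2 = g w}].

(* Separability in the sense of Doob: off a null set, every X_t is a limit of
   values of the path along one fixed countable set of times. *)
Definition separable_process (X : R -> {RV P >-> R}) : Prop :=
  exists D : set R, [/\ countable D, D `<=` [set t | 0 < t] &
    {ae P, forall w, forall t : R, 0 < t ->
       exists t_ : nat -> R, [/\ forall n, D (t_ n),
         t_ n @[n --> \oo] --> t & X (t_ n) w @[n --> \oo] --> X t w]}].

End conditioning.

Definition Delta (R : realType) (T : Type) (X : R -> T -> R) (s u : R) (w : T)
    : R :=
  (X u w - X s w) / (u - s).

Definition tDelta (R : realType) (T : Type) (X : R -> T -> R) (s u : R) (w : T)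
    : R :=
  (u * X s w - s * X u w) / (u - s).

Record quadratic_harness (d : measure_display) (T : measurableType d)
    (R : realType) (P : probability T R) (X : R -> {RV P >-> R})
    (q eta theta sigma tau : R) : Prop := {
  qh_sigma : 0 <= sigma;
  qh_tau : 0 <= tau;
  qh_q : q <= 1 + 2 * Num.sqrt (sigma * tau);
  qh_separable : separable_process X;
  qh_square : forall t : R, 0 < t -> (X t : T -> R) \in Lfun P 2%:E;
  qh_mean : forall t : R, 0 < t -> ('E_P[X t] = 0)%E;
  qh_cov : forall s t : R, 0 < s -> 0 < t ->
    ('E_P[fun w => (X s w * X t w)%R] = (Num.min s t)%:E)%E;
  qh_harness : forall s t u : R, 0 < s -> s < t -> t < u ->
    condexp_eq P (sigma_past_future X s u) (X t)
      (fun w => (u - t) / (u - s) * X s w + (t - s) / (u - s) * X u w);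
  qh_quadratic : forall s t u : R, 0 < s -> s < t -> t < u ->
    condvar_eq P (sigma_past_future X s u) (X t)
      (fun w => let D := Delta X s u w in let tD := tDelta X s u w in
        (u - t) * (t - s) / (u * (1 + sigma * s) + tau - q * s) *
        (1 + eta * tD + theta * D + sigma * tD ^+ 2 + tau * D ^+ 2
           - (1 - q) * D * tD)) }.

Definition finite_moments (d : measure_display) (T : measurableType d)
    (R : realType) (P : probability T R) (X : R -> {RV P >-> R}) : Prop :=
  forall t : R, 0 < t -> forall n : nat, (fun w => X t w ^+ n) \in Lfun P 1.

(* [p n t] is the polynomial x |-> p_n(x;t) *)
Record orthogonal_martingale_polynomials (d : measure_display)
    (T : measurableType d) (R : realType) (P : probability T R)
    (X : R -> {RV P >-> R}) (p : nat -> R -> {poly R}) : Prop := {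
  omp_degree : forall (n : nat) (t : R), 0 < t -> size (p n t) = n.+1;
  omp_martingale : forall (n : nat) (s t : R), 0 < s -> s < t ->
    condexp_eq P (sigma_past X s)
      (fun w => (p n t).[X t w]) (fun w => (p n s).[X s w]);
  omp_orthogonal : forall (n m : nat) (t : R), 0 < t -> n <> m ->
    ('E_P[fun w => ((p n t).[X t w] * (p m t).[X t w])%R] = 0)%E }.

(* Main.v *)
(* Induction on n for the martingale property.  Fix a past event A in F_s and
   let w_t be the error E[1_A (X_t p_n(X_t;t))] minus its predicted value, both
   computed through the recurrence.  Averaging X_t p_n(X_u;u) over A, once with
   the martingale property at time t and once with the harness property, gives
   w_t = (t-s)/(u-s) w_u.  Averaging X_t^2 p_{n-1}(X_u;u) with the quadratic
   conditional variance gives a second linear relation between w_t and w_u: the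
   equations (a)-(e) say exactly that the two Jacobi matrices x, y with
   J_t = t x + y satisfy xy - q yx = tau x^2 + sigma y^2 + theta x + eta y + 1,
   which makes the predicted values a solution.  The determinant of the two
   relations is a nonzero multiple of a_n(s) by (a), the only way to degenerate
   being (q, sigma tau) = (-1, 1); hence w_t = 0.  Orthogonality follows from
   the recurrence once E p_n(X_t;t) = 0 for n >= 1. *)
Require Import Defs.
From HB Require Import structures.
From mathcomp Require Import all_boot all_order all_algebra.
From mathcomp Require Import all_classical all_reals all_analysis.
From mathcomp Require Import measurable_realfun zify ring lra.

Set Implicit Arguments.
Unset Strict Implicit.
Unset Printing Implicit Defensive.

Import Order.TTheory GRing.Theory Num.Theory.
Import numFieldNormedType.Exports HBNNSimple.

Local Open Scope classical_set_scope.
Local Open Scope ring_scope.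

(** * Conditional expectations: taking out what is known *)

Section pull_out.
Context (d : measure_display) (T : measurableType d) (R : realType)
        (P : probability T R).
Variables (S : set (set T)).
Hypothesis subS : <<s S >> `<=` measurable.

Local Notation intf := (fun f : T -> R => P.-integrable setT (EFin \o f)).

Lemma integrable_on (A : set T) (f : T -> R) :
  measurable A -> intf f -> P.-integrable A (EFin \o f).
Proof. by move=> mA; apply: integrableS. Qed.

Lemma integrable_mfun (f : T -> R) : intf f -> measurable_fun setT f.
Proof. by move/integrableP => [/measurable_EFinP]. Qed.

Lemma gmeas_mfun (Y : g_sigma_algebraType S -> R) :
  measurable_fun setT Y -> measurable_fun [set: T] Y.
Proof. by move=> mY _ B mB; apply: subS; exact: mY. Qed.

Lemma sigma_algebraI (A B : set T) : <<s S >> A -> <<s S >> B ->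
  <<s S >> (A `&` B).
Proof. exact: (@measurableI _ (g_sigma_algebraType S)). Qed.

Lemma sigma_algebraC (A : set T) : <<s S >> A -> <<s S >> (~` A).
Proof. exact: (@measurableC _ (g_sigma_algebraType S)). Qed.

(** [phi \o Y] is a finite combination of indicators of level sets of [Y], which belong to
    [<<s S >>]; each term is then an integral of [k] over an event of [<<s S >>]. *)
Lemma integral_sfun_mul0 (phi : {nnsfun R >-> R}) (k : T -> R)
    (Y : g_sigma_algebraType S -> R) (A : set T) :
  intf k -> (forall A, <<s S >> A -> \int[P]_(w in A) k w = 0) ->
  measurable_fun setT Y -> <<s S >> A ->
  \int[P]_(w in A) (phi (Y w) * k w) = 0.
Proof.
move=> ik k0 mY GA.
have mA : measurable A by exact: subS.
pose B r : set T := Y @^-1` (phi @^-1` [set r]).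
have GB r : <<s S >> (B r).
  by rewrite -[B r]setTI; apply: mY => //; exact: measurable_sfunP.
have mB r : measurable (B r) by exact: subS.
pose F r := k \_ (B r).
have iF r : P.-integrable A (EFin \o F r).
  rewrite /F -restrict_EFin; apply/integrable_restrict => //.
  by apply: integrable_on => //; exact: measurableI.
have F0 r : \int[P]_(w in A) (F r w) = 0.
  by rewrite -Rintegral_mkcondr; apply: k0; apply: sigma_algebraI => //; exact: (GB r).
have [s phiE] : exists s : seq R,
    forall y, phi y = \sum_(r <- s) r * \1_(phi @^-1` [set r]) y.
  by eexists => y; rewrite fimfunE fsbig_finite.
have -> : (fun w => phi (Y w) * k w) = (fun w => \sum_(r <- s) r * F r w).
  apply/funext => w; rewrite phiE mulr_suml.
  apply: eq_bigr => r _; rewrite /F patchE/= indicE.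
  have -> : (Y w \in phi @^-1` [set r]) = (w \in B r) by apply/idP/idP; rewrite !inE.
  by case: ifPn => _; rewrite ?mulr1 ?mulr0 ?mul0r.
elim: s {phiE} => [|r s IH].
  by under eq_Rintegral do rewrite big_nil; rewrite Rintegral_cst// mul0r.
under eq_Rintegral do rewrite big_cons.
rewrite RintegralD//.
- by rewrite RintegralZl// F0 mulr0 add0r.
- by apply: (@integrableZl _ _ _ P A mA _ (EFin \o F r)).
- rewrite (_ : _ \o _ = (fun w => \sum_(i <- s) (i * F i w)%:E)%E); last first.
    by apply/funext => w /=; rewrite sumEFin.
  apply: integrable_sum => //= i _.
  by apply: (@integrableZl _ _ _ P A mA i (EFin \o F i)).
Qed.

(* Dominated convergence along the simple approximations of the positive part
   of the identity of R, composed with Y. *)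
Lemma integral_pos_mul0 (k : T -> R) (Y : g_sigma_algebraType S -> R)
    (A : set T) :
  intf k -> (forall A, <<s S >> A -> \int[P]_(w in A) k w = 0) ->
  measurable_fun setT Y -> (forall w, 0 <= Y w) ->
  intf (fun w => Y w * k w) -> <<s S >> A ->
  \int[P]_(w in A) (Y w * k w) = 0.
Proof.
move=> ik k0 mY Y0 iYk GA.
have mA : measurable A by exact: subS.
have mYT := gmeas_mfun mY.
have mk := integrable_mfun ik.
have mp : measurable_fun [set: R] (fun y : R => (Num.max y 0)%:E).
  by apply/measurable_EFinP; exact: measurable_maxr.
have p0 y : [set: R] y -> (0 <= (Num.max y 0)%:E)%E.
  by move=> _; rewrite lee_fin le_max lexx orbT.
pose phi n := nnsfun_approx measurableT mp n.
have phi_le n w : phi n (Y w) <= Y w.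
  rewrite -lee_fin /phi nnsfun_approxE.
  by apply: (le_trans (le_approx _ p0 I)) => /=; rewrite (max_idPl (Y0 w)).
have phi_norm n w : `|phi n (Y w) * k w| <= `|Y w * k w|.
  by rewrite !normrM ler_wpM2r// !ger0_norm// phi_le.
have mphi n : measurable_fun A (EFin \o (fun w => phi n (Y w) * k w)).
  apply/measurable_EFinP; apply: measurable_funTS; apply: measurable_funM => //.
  exact: measurableT_comp.
have [] := @dominated_convergence _ _ _ P _ mA
  (fun n => EFin \o (fun w => phi n (Y w) * k w))
  (EFin \o (fun w => Y w * k w)) (abse \o (EFin \o (fun w => Y w * k w))) mphi.
- by apply/measurable_EFinP; apply: measurable_funTS; exact: integrable_mfun.
- apply: aeW => w _ /=.
  apply: cvg_EFin; first by apply: nearW.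
  apply: cvgMl.
  have := @cvg_nnsfun_approx _ _ _ _ measurableT _ mp p0 (Y w) I.
  by rewrite (max_idPl (Y0 w)) => /fine_cvg.
- exact/integrable_abse/integrable_on.
- apply: aeW => w /= n _; rewrite lee_fin; exact: phi_norm.
have E0 n : (\int[P]_(w in A) (phi n (Y w) * k w)%:E = 0)%E.
  have := congr1 EFin (integral_sfun_mul0 (phi n) ik k0 mY GA).
  rewrite /Rintegral fineK//; apply: integrable_fin_num => //.
  apply: (le_integrable mA (mphi n) _ (integrable_on mA iYk)) => w _ /=.
  by rewrite lee_fin; exact: phi_norm.
move=> _ _; rewrite (_ : [sequence _]_n = (fun=> 0%E)); last exact/funext.
by move=> /(cvg_unique (@ereal_hausdorff R) (cvg_cst _)) /(congr1 fine)/esym.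
Qed.

(** The positive and negative parts of [Y] are treated separately; their products with [k] are
    integrable because [|Y k|] dominates both. *)
Lemma integral_mul0 (k : T -> R) (Y : g_sigma_algebraType S -> R) (A : set T) :
  intf k -> (forall A, <<s S >> A -> \int[P]_(w in A) k w = 0) ->
  measurable_fun setT Y -> intf (fun w => Y w * k w) -> <<s S >> A ->
  \int[P]_(w in A) (Y w * k w) = 0.
Proof.
move=> ik k0 mY iYk GA.
have mA : measurable A by exact: subS.
have mk := integrable_mfun ik.
have mp := measurable_funrpos mY; have mn := measurable_funrneg mY.
have [ip im] : intf (fun w => Y^\+ w * k w) /\ intf (fun w => Y^\- w * k w).
  split; apply: (le_integrable measurableT _ _ iYk).
  - by apply/measurable_EFinP; apply: measurable_funM => //; exact: gmeas_mfun.
  - move=> w _ /=; rewrite lee_fin !normrM ler_wpM2r// ger0_norm ?funrpos_ge0//.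
    by rewrite /funrpos ge_max ler_norm normr_ge0.
  - by apply/measurable_EFinP; apply: measurable_funM => //; exact: gmeas_mfun.
  - move=> w _ /=; rewrite lee_fin !normrM ler_wpM2r// ger0_norm ?funrneg_ge0//.
    by rewrite /funrneg ge_max -normrN ler_norm normr_ge0.
have -> : (fun w => Y w * k w) = (fun w => Y^\+ w * k w - Y^\- w * k w).
  by apply/funext => w; rewrite -mulrBl -{1}(funrposBneg Y).
rewrite RintegralB//; try exact: integrable_on.
by rewrite !integral_pos_mul0 ?subrr// => w; rewrite (funrpos_ge0, funrneg_ge0).
Qed.

Lemma condexp_unique (k : g_sigma_algebraType S -> R) :
  intf k -> measurable_fun setT k ->
  (forall A, <<s S >> A -> \int[P]_(w in A) k w = 0) ->
  {ae P, forall w, k w = 0}.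
Proof.
move=> ik mk k0.
pose A : set T := k @^-1` `[0, +oo[.
have GA : <<s S >> A by rewrite -[A]setTI; apply: mk.
have GB := sigma_algebraC GA.
have mA := subS GA.
have mB := subS GB.
have mkT := integrable_mfun ik.
have nfin (B : set T) : measurable B ->
    (\int[P]_(w in B) `|k w|%:E)%E \is a fin_num.
  move=> hB; apply: integrable_fin_num => //.
  exact/integrable_norm/integrable_on.
have : (\int[P]_(w in setT) `|(EFin \o k) w| = 0)%E.
  rewrite -(setUv A) integral_setU//=; first last.
  - by rewrite disj_set2E setICr.
  - by rewrite setUv; apply/measurable_EFinP; exact: measurableT_comp.
  rewrite -[LHS]fineK; last by rewrite fin_numD !nfin.
  rewrite fineD ?nfin//.
  rewrite -/(Rintegral P A (fun w => `|k w|)).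
  rewrite -/(Rintegral P (~` A) (fun w => `|k w|)).
  rewrite (@eq_Rintegral _ _ _ _ A k); last first.
    by move=> w; rewrite inE /A/= in_itv/= andbT => /ger0_norm.
  rewrite (@eq_Rintegral _ _ _ _ (~` A) (fun w => -1 * k w)); last first.
    move=> w; rewrite inE /A/= in_itv/= andbT => /negP.
    by rewrite -ltNge mulN1r => /ltr0_norm.
  by rewrite RintegralZl ?k0 ?mulr0 ?addr0//; exact: integrable_on.
have mE : measurable_fun [set: T] (EFin \o k) by exact/measurable_EFinP.
move=> /(iffLR (ae_eq_integral_abs P measurableT mE)).
by apply: filterS => w /= /(_ I) [].
Qed.

End pull_out.

(** * Random variables with all moments *)

Section moments.
Context (d : measure_display) (T : measurableType d) (R : realType)
        (P : probability T R).

(** This class is closed under sums, products and polynomials, which settles the integrability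
    conditions for all expressions built from the process. *)
Definition all_moments (f : T -> R) : Prop := measurable_fun setT f /\
  forall n, P.-integrable setT (EFin \o (fun w => f w ^+ n)).

Lemma all_moments_integrable (f : T -> R) :
  all_moments f -> P.-integrable setT (EFin \o f).
Proof. by move=> [_ /(_ 1%N)]. Qed.

Lemma dominated_real_integrable (f g : T -> R) : measurable_fun setT f ->
  P.-integrable setT (EFin \o g) -> (forall w, `|f w| <= g w) ->
  P.-integrable setT (EFin \o f).
Proof.
move=> mf ig fg; apply: (le_integrable measurableT _ _ ig).
  exact/measurable_EFinP.
by move=> w _ /=; rewrite lee_fin (le_trans (fg w))// ler_norm.
Qed.

Lemma integrable_EFinD (f g : T -> R) : P.-integrable setT (EFin \o f) ->
  P.-integrable setT (EFin \o g) ->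
  P.-integrable setT (EFin \o (fun w => f w + g w)).
Proof.
move=> hf hg; rewrite (_ : _ \o _ = (EFin \o f) \+ (EFin \o g))%E.
  exact: integrableD.
by apply/funext.
Qed.

Lemma integrable_EFinZ (r : R) (f : T -> R) : P.-integrable setT (EFin \o f) ->
  P.-integrable setT (EFin \o (fun w => r * f w)).
Proof. by move=> hf; apply: (@integrableZl _ _ _ P _ measurableT r (EFin \o f)). Qed.

Lemma all_moments_cst (r : R) : all_moments (fun=> r).
Proof. by split=> // n; apply: finite_measure_integrable_cst. Qed.

(** With [x = f ^+ n] and [y = g ^+ n], the bound is [|x y| <= x ^+ 2 + y ^+ 2]. *)
Lemma all_momentsM (f g : T -> R) : all_moments f -> all_moments g ->
  all_moments (fun w => f w * g w).
Proof.
move=> [mf If] [mg Ig]; split=> [|n]; first exact: measurable_funM.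
apply: (@dominated_real_integrable _ (fun w => f w ^+ (n * 2) + g w ^+ (n * 2))).
- by apply: measurable_funX; exact: measurable_funM.
- exact: integrable_EFinD.
- move=> w; rewrite exprMn !exprM normrM.
  rewrite -(real_normK (num_real (f w ^+ n))) -(real_normK (num_real (g w ^+ n))).
  move: `|f w ^+ n| `|g w ^+ n| (normr_ge0 (f w ^+ n)) (normr_ge0 (g w ^+ n)) => x y.
  by move=> x0 y0; have := sqr_ge0 (x - y); nra.
Qed.

Lemma all_momentsD (f g : T -> R) : all_moments f -> all_moments g ->
  all_moments (fun w => f w + g w).
Proof.
move=> [mf If] [mg Ig]; split=> [|n]; first exact: measurable_funD.
apply: (@dominated_real_integrable _
  (fun w => 2 ^+ n * (`|f w ^+ n| + `|g w ^+ n|))).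
- by apply: measurable_funX; exact: measurable_funD.
- by apply: integrable_EFinZ; apply: integrable_EFinD;
    exact: integrable_norm.
- move=> w; rewrite !normrX.
  have h : `|f w + g w| <= 2 * Num.max `|f w| `|g w|.
    rewrite (le_trans (ler_normD _ _))// mulr_natl mulr2n lerD//.
      by rewrite le_max lexx.
    by rewrite le_max lexx orbT.
  have h0 : 0 <= 2 * Num.max `|f w| `|g w| by rewrite mulr_ge0// le_max normr_ge0.
  rewrite (@le_trans _ _ ((2 * Num.max `|f w| `|g w|) ^+ n)) ?lerXn2r ?nnegrE//.
  rewrite exprMn ler_wpM2l ?exprn_ge0//.
  by rewrite maxEle; case: ifP => _; rewrite ?lerDl ?lerDr exprn_ge0.
Qed.

Lemma all_moments_horner (p : {poly R}) (f : T -> R) :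
  all_moments f -> all_moments (fun w => p.[f w]).
Proof.
move=> hf; elim/poly_ind: p => [|p r IH].
  by under eq_fun do rewrite horner0; exact: all_moments_cst.
under eq_fun do rewrite hornerMXaddC.
by apply: all_momentsD; [exact: all_momentsM|exact: all_moments_cst].
Qed.

Lemma RintegralD_moments (A : set T) (f g : T -> R) : measurable A ->
  all_moments f -> all_moments g ->
  \int[P]_(w in A) (f w + g w) = \int[P]_(w in A) f w + \int[P]_(w in A) g w.
Proof.
by move=> mA /all_moments_integrable hf /all_moments_integrable hg;
   rewrite RintegralD//; exact: integrable_on.
Qed.

Lemma RintegralZ_moments (A : set T) (r : R) (f : T -> R) : measurable A ->
  all_moments f ->
  \int[P]_(w in A) (r * f w) = r * \int[P]_(w in A) f w.
Proof.
by move=> mA /all_moments_integrable hf; rewrite RintegralZl//; exact: integrable_on.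
Qed.

(* AM-GM: |f g| <= (f^2 / r + r g^2) / 2 *)
Lemma Rintegral_prod_le (A : set T) (f g : T -> R) (r : R) : measurable A ->
  all_moments f -> all_moments g -> 0 < r ->
  `|\int[P]_(w in A) (f w * g w)| <=
  (\int[P]_w (f w ^+ 2) / r + r * \int[P]_w (g w ^+ 2)) / 2.
Proof.
move=> mA hf hg r0.
have hfg := all_momentsM hf hg.
have h2 := (all_momentsM hf hf, all_momentsM hg hg).
pose h w := r^-1 / 2 * (f w * f w) + r / 2 * (g w * g w).
have hh : all_moments h.
  by apply: all_momentsD; apply: all_momentsM; rewrite ?h2//;
     first exact: all_moments_cst; try exact: h2.1; try exact: h2.2;
     exact: all_moments_cst.
have -> : (\int[P]_w (f w ^+ 2) / r + r * \int[P]_w (g w ^+ 2)) / 2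
   = \int[P]_w h w.
  rewrite RintegralD_moments//; try by
    apply: all_momentsM; [exact: all_moments_cst|exact: all_momentsM].
  rewrite (@RintegralZ_moments _ (r^-1 / 2) (fun w => f w * f w))//; last first.
    exact: all_momentsM.
  rewrite (@RintegralZ_moments _ (r / 2) (fun w => g w * g w))//; last first.
    exact: all_momentsM.
  rewrite -(@eq_Rintegral _ _ _ P setT (fun w => f w ^+ 2)
    (fun w => f w * f w)); last by move=> w _; rewrite expr2.
  rewrite -(@eq_Rintegral _ _ _ P setT (fun w => g w ^+ 2)
    (fun w => g w * g w)); last by move=> w _; rewrite expr2.
  by field; rewrite gt_eqF.
have ihh := all_moments_integrable hh.
have ihfg := all_moments_integrable hfg.
apply: (le_trans (le_normr_Rintegral mA (integrable_on mA ihfg))).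
have hle w : `|f w * g w| <= h w.
  rewrite /h -!expr2 normrM -(real_normK (num_real (f w))) -(real_normK (num_real (g w))).
  move: `|f w| `|g w| => x y.
  have : 0 <= (x - r * y) ^+ 2 / (2 * r) by rewrite divr_ge0 ?sqr_ge0// mulr_ge0// ltW.
  suff -> : (x - r * y) ^+ 2 / (2 * r) = r^-1 / 2 * x ^+ 2 + r / 2 * y ^+ 2 - x * y.
    by rewrite subr_ge0.
  by field; rewrite gt_eqF.
apply: (@le_trans _ _ (\int[P]_(w in A) h w)).
  apply: le_Rintegral => //; last exact: integrable_on.
  exact/integrable_norm/integrable_on.
rewrite Rintegral_mkcond; apply: le_Rintegral => //.
  by rewrite -restrict_EFin; apply/integrable_restrict => //;
    rewrite setTI; exact: integrable_on.
move=> w _; rewrite patchE; case: ifP => // _.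
exact: le_trans (normr_ge0 _) (hle w).
Qed.
End moments.

(** * Averages over the events generated by a process *)

Section process.
Context (d : measure_display) (T : measurableType d) (R : realType)
        (P : probability T R) (X : R -> {RV P >-> R}).

Definition process_gen (I : set R) : set (set T) :=
  \bigcup_(t in I) preimage_set_system setT (X t) measurable.

Lemma sigma_process_measurable I : sigma_process X I `<=` @measurable _ T.
Proof.
apply: smallest_sub; first exact: sigma_algebra_measurable.
by move=> A [t _ [B mB <-]]; apply: measurable_funP.
Qed.

Lemma sigma_process_sub I J : I `<=` J -> sigma_process X I `<=` sigma_process X J.
Proof.
move=> IJ; apply: sub_sigma_algebra2 => A [t It XA].
by exists t => //; exact: IJ.
Qed.

Definition process_measurable (I : set R) (f : T -> R) : Prop :=
  measurable_fun setT (f : g_sigma_algebraType (process_gen I) -> R).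

Lemma process_measurableX I t : I t -> process_measurable I (X t).
Proof.
move=> It _ B mB; apply: sub_sigma_algebra; exists t => //; exists B => //.
Qed.

(** The averaging clause of conditional expectation alone; integrability and measurability are
    supplied separately. *)
Definition avg_eq (I : set R) (f g : T -> R) : Prop := forall A,
  sigma_process X I A -> \int[P]_(w in A) f w = \int[P]_(w in A) g w.

Lemma condexp_eq_avg I f g : measurable_fun setT g ->
  condexp_eq P (sigma_process X I) f g -> avg_eq I f g.
Proof.
move=> mg [h [_ /Lfun1_integrable ih _ havg] hg] A GA.
have mA := sigma_process_measurable GA.
rewrite /Rintegral -havg//; congr fine; apply: ae_eq_integral => //.
- by apply/measurable_EFinP; apply: measurable_funTS; exact: integrable_mfun ih.
- by apply/measurable_EFinP; apply: measurable_funTS.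
- by apply: filterS hg => w -> _.
Qed.

Lemma avg_condexp_eq I f g : all_moments P f -> all_moments P g ->
  process_measurable I g -> avg_eq I f g ->
  condexp_eq P (sigma_process X I) f g.
Proof.
move=> hf hg mg fg; exists g; last exact: aeW.
have [/all_moments_integrable fi /all_moments_integrable gi] := (hf, hg).
split; try exact/Lfun1_integrable.
- by move=> B mB; rewrite -[_ @^-1` _]setTI; exact: mg.
- move=> A GA; have mA := sigma_process_measurable GA.
  rewrite -[LHS]fineK ?integrable_fin_num//; last exact: integrable_on.
  rewrite -[RHS]fineK ?integrable_fin_num//; last exact: integrable_on.
  by congr EFin; rewrite [RHS](fg _ GA).
Qed.

(** The difference of [f] and [g] averages to zero over every event of the sigma-algebra, so
    [integral_mul0] applies to it. *)
Lemma avg_eqM I f g Y : all_moments P f -> all_moments P g -> all_moments P Y ->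
  process_measurable I Y -> avg_eq I f g ->
  avg_eq I (fun w => Y w * f w) (fun w => Y w * g w).
Proof.
move=> hf hg hY mY fg A GA; have mA := sigma_process_measurable GA.
pose k w := f w + -1 * g w.
have hk : all_moments P k.
  by apply: all_momentsD => //; apply: all_momentsM => //; exact: all_moments_cst.
have hng : all_moments P (fun w => -1 * g w).
  by apply: all_momentsM => //; exact: all_moments_cst.
have k0 B : <<s process_gen I >> B -> \int[P]_(w in B) k w = 0.
  move=> GB; have mB := sigma_process_measurable GB.
  by rewrite RintegralD_moments// RintegralZ_moments// (fg _ GB) mulN1r subrr.
have := integral_mul0 (@sigma_process_measurable I)
  (all_moments_integrable hk) k0 mY (all_moments_integrable (all_momentsM hY hk)) GA.
rewrite (_ : (fun w => Y w * k w) = (fun w => Y w * f w + -1 * (Y w * g w))).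
  rewrite RintegralD_moments//; last 2 first.
  - exact: all_momentsM.
  - by apply: all_momentsM; [exact: all_moments_cst|exact: all_momentsM].
  rewrite RintegralZ_moments//; last exact: all_momentsM.
  by rewrite mulN1r => /eqP; rewrite subr_eq0 => /eqP.
by apply/funext => w; rewrite /k; ring.
Qed.

End process.

(** * The algebra of the recurrence coefficients *)

Section algebra.
Variable R : realFieldType.

(* [XX], [XY], ..., [Xe], [Ye], [Ie] stand for corresponding entries of xx, xy,
   ..., x, y, 1, where J_t = t x + y. *)
Lemma quadratic_harness_qcommutation (q eta theta sigma tau s t u : R)
    (XX XY YX YY Xe Ye Ie : R) :
  u - s != 0 -> u * (1 + sigma * s) + tau - q * s != 0 ->
  XY = q * YX + tau * XX + sigma * YY + theta * Xe + eta * Ye + Ie ->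
  let Jss := s ^+ 2 * XX + s * (XY + YX) + YY in
  let Jsu := s * u * XX + s * XY + u * YX + YY in
  let Juu := u ^+ 2 * XX + u * (XY + YX) + YY in
  let Js := s * Xe + Ye in let Ju := u * Xe + Ye in
  let k := (u - t) / (u - s) in let l := (t - s) / (u - s) in
  t ^+ 2 * XX + t * (XY + YX) + YY =
  (u - t) * (t - s) / (u * (1 + sigma * s) + tau - q * s) *
    (Ie + eta * ((u * Js - s * Ju) / (u - s)) + theta * ((Ju - Js) / (u - s))
     + sigma * ((u ^+ 2 * Jss - 2 * (u * s) * Jsu + s ^+ 2 * Juu) / (u - s) ^+ 2)
     + tau * ((Juu - 2 * Jsu + Jss) / (u - s) ^+ 2)
     - (1 - q) * (((u + s) * Jsu - s * Juu - u * Jss) / (u - s) ^+ 2))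
  + (k ^+ 2 * Jss + 2 * (k * l) * Jsu + l ^+ 2 * Juu).
Proof.
move=> us N0 -> Jss Jsu Juu Js Ju k l.
rewrite /k /l /Jss /Jsu /Juu /Js /Ju; field.
by rewrite us N0.
Qed.

(** [et] and [eu] are the errors at times [t] and [u]; the last factor of the second relation is the
    coefficient of X_u^2 in E[X_t^2 | F_{s,u}]. Eliminating [et] leaves [eu] times a nonzero
    determinant. *)
Lemma quadratic_harness_error (q sigma tau s t u xa ya et eu : R) :
  u - s != 0 -> t - u != 0 -> t - s != 0 ->
  u * (1 + sigma * s) + tau - q * s != 0 ->
  xa * (tau - q * s) - ya * (1 + sigma * s) != 0 ->
  et = (t - s) / (u - s) * eu ->
  (xa * t + ya) * et = (xa * u + ya) * eu *
    ((u - t) * (t - s) / (u * (1 + sigma * s) + tau - q * s) *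
       ((sigma * s ^+ 2 + tau + (1 - q) * s) / (u - s) ^+ 2)
     + ((t - s) / (u - s)) ^+ 2) ->
  et = 0.
Proof.
move=> us ut ts N0 D0 Eet; rewrite Eet => E2.
suff -> : eu = 0 by rewrite mulr0.
have : (t - u) * (t - s) * (xa * (tau - q * s) - ya * (1 + sigma * s)) * eu
   / ((u - s) * (u * (1 + sigma * s) + tau - q * s)) = 0.
  rewrite -(subrr ((xa * t + ya) * ((t - s) / (u - s) * eu))) {2}E2; field.
  by rewrite us N0.
move/eqP; rewrite mulf_eq0 invr_eq0 !mulf_eq0.
by rewrite (negPf us) (negPf ut) (negPf ts) (negPf N0) (negPf D0) /= !orbF => /eqP.
Qed.

(** The denominator is [(u - s) * (1 + sigma * s)] plus [sigma * s ^+ 2 + tau + (1 - q) * s]. The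
    bound on [q], with [r] the square root of [sigma * tau], makes the second summand at least the
    square of sqrt(sigma) s - sqrt(tau). *)
Lemma harness_denominator_gt0 (q sigma tau r s u : R) :
  0 <= sigma -> 0 <= tau -> 0 <= r -> r ^+ 2 = sigma * tau ->
  q <= 1 + 2 * r -> 0 < s -> s < u ->
  0 < u * (1 + sigma * s) + tau - q * s.
Proof.
move=> s0 t0 r0 r2 hq sp su.
have qs : q * s <= (1 + 2 * r) * s by rewrite ler_pM2r.
have us : 0 < (u - s) * (1 + sigma * s).
  by rewrite mulr_gt0 ?subr_gt0// ltr_wpDr// mulr_ge0// ltW.
suff : 0 <= sigma * s ^+ 2 + tau - 2 * r * s by nra.
have [z|p] : sigma = 0 \/ 0 < sigma
  by move: s0; rewrite le_eqVlt => /orP[/eqP<-|]; [left|right].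
  have -> : r = 0 by apply/eqP; rewrite -(sqrf_eq0 r) r2 z mul0r.
  by rewrite z; lra.
rewrite -(pmulr_rge0 _ p).
have -> : sigma * (sigma * s ^+ 2 + tau - 2 * r * s) = (sigma * s - r) ^+ 2.
  rewrite sqrrB r2; ring.
exact: sqr_ge0.
Qed.
(** By the commutation relation the predicted moments satisfy the quadratic identity on their own.
    Subtracting them leaves a relation between the errors, which enter the second moments only at
    the time pairs (t, t) and (u, u). *)
Lemma quadratic_harness_closure (q eta theta sigma tau s t u xa ya et eu : R)
    (XX XY YX YY Xe Ye Ie : R) :
  u - s != 0 -> t - u != 0 -> t - s != 0 ->
  u * (1 + sigma * s) + tau - q * s != 0 ->
  xa * (tau - q * s) - ya * (1 + sigma * s) != 0 ->
  XY = q * YX + tau * XX + sigma * YY + theta * Xe + eta * Ye + Ie ->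
  et = (t - s) / (u - s) * eu ->
  let Jss := s ^+ 2 * XX + s * (XY + YX) + YY in
  let Jsu := s * u * XX + s * XY + u * YX + YY in
  let Juu := u ^+ 2 * XX + u * (XY + YX) + YY + (xa * u + ya) * eu in
  let Js := s * Xe + Ye in let Ju := u * Xe + Ye in
  let k := (u - t) / (u - s) in let l := (t - s) / (u - s) in
  t ^+ 2 * XX + t * (XY + YX) + YY + (xa * t + ya) * et =
  (u - t) * (t - s) / (u * (1 + sigma * s) + tau - q * s) *
    (Ie + eta * ((u * Js - s * Ju) / (u - s)) + theta * ((Ju - Js) / (u - s))
     + sigma * ((u ^+ 2 * Jss - 2 * (u * s) * Jsu + s ^+ 2 * Juu) / (u - s) ^+ 2)
     + tau * ((Juu - 2 * Jsu + Jss) / (u - s) ^+ 2)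
     - (1 - q) * (((u + s) * Jsu - s * Juu - u * Jss) / (u - s) ^+ 2))
  + (k ^+ 2 * Jss + 2 * (k * l) * Jsu + l ^+ 2 * Juu) ->
  et = 0.
Proof.
move=> us tu ts N0 D0 comm Eet Jss Jsu Juu Js Ju k l E.
apply: (quadratic_harness_error us tu ts N0 D0 Eet).
have := quadratic_harness_qcommutation t us N0 comm.
move=> /= C; apply: (addrI (t ^+ 2 * XX + t * (XY + YX) + YY)).
rewrite E {}C /Juu /Jss /Jsu /Js /Ju /k /l; field.
by rewrite us N0.
Qed.

(** [m2], [m1], [m0], [mm], [mmm] stand for the averages of p_{n+2} down to p_{n-2}. Their
    coefficients in the difference of the two sides are the defects of (a), (b), (c), (d), (e) in
    this order, so the claim is one row of the q-commutation of x and y. *)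
Lemma qcommutation_row (q eta theta sigma tau : R)
    (al0 al1 al2 be0 be1 be2 gam ga0 ga1 dem de0 de1 : R)
    (epm ep0 ep1 phm ph0 ph1 m0 m1 m2 mm mmm : R) :
  sigma ^+ 2 * tau * al1 * al2 + sigma * q * al1 * be2 + sigma * be1 * be2
    = sigma * al2 * be1 ->
  be1 * ga1 + sigma * al1 * de0
    = sigma * tau * al1 * (ga0 + ga1) + q * (sigma * al1 * de1 + be1 * ga0)
      + sigma * be1 * (de0 + de1) + sigma * al1 * theta + be1 * eta ->
  be1 * ep1 + ga0 * de0 + sigma * al0 * ph0
    = tau * (sigma * al1 * ep1 + ga0 ^+ 2 + sigma * al0 * ep0)
      + q * (sigma * al1 * ph1 + ga0 * de0 + be0 * ep0)
      + sigma * (be1 * ph1 + de0 ^+ 2 + be0 * ph0)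
      + ga0 * theta + de0 * eta + 1 ->
  gam * ph0 + de0 * ep0
    = tau * (gam + ga0) * ep0 + q * (ga0 * ph0 + dem * ep0)
      + sigma * (dem + de0) * ph0 + ep0 * theta + ph0 * eta ->
  epm * ph0 = tau * epm * ep0 + q * ep0 * phm + sigma * phm * ph0 ->
  let x1 := sigma * al2 * m2 + ga1 * m1 + ep1 * m0 in
  let y1 := be2 * m2 + de1 * m1 + ph1 * m0 in
  let x0 := sigma * al1 * m1 + ga0 * m0 + ep0 * mm in
  let y0 := be1 * m1 + de0 * m0 + ph0 * mm in
  let xm := sigma * al0 * m0 + gam * mm + epm * mmm in
  let ym := be0 * m0 + dem * mm + phm * mmm in
  be1 * x1 + de0 * x0 + ph0 * xm =
  q * (sigma * al1 * y1 + ga0 * y0 + ep0 * ym)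
  + tau * (sigma * al1 * x1 + ga0 * x0 + ep0 * xm)
  + sigma * (be1 * y1 + de0 * y0 + ph0 * ym) + theta * x0 + eta * y0 + m0.
Proof.
move=> Ea Eb Ec Ed Ee x1 y1 x0 y0 xm ym.
apply/eqP; rewrite -subr_eq0; apply/eqP.
transitivity (m2 * (sigma * al2 * be1 - (sigma ^+ 2 * tau * al1 * al2
    + sigma * q * al1 * be2 + sigma * be1 * be2))
  + m1 * (be1 * ga1 + sigma * al1 * de0
     - (sigma * tau * al1 * (ga0 + ga1) + q * (sigma * al1 * de1 + be1 * ga0)
      + sigma * be1 * (de0 + de1) + sigma * al1 * theta + be1 * eta))
  + m0 * (be1 * ep1 + ga0 * de0 + sigma * al0 * ph0
     - (tau * (sigma * al1 * ep1 + ga0 ^+ 2 + sigma * al0 * ep0)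
      + q * (sigma * al1 * ph1 + ga0 * de0 + be0 * ep0)
      + sigma * (be1 * ph1 + de0 ^+ 2 + be0 * ph0)
      + ga0 * theta + de0 * eta + 1))
  + mm * (gam * ph0 + de0 * ep0 - (tau * (gam + ga0) * ep0
      + q * (ga0 * ph0 + dem * ep0)
      + sigma * (dem + de0) * ph0 + ep0 * theta + ph0 * eta))
  + mmm * (epm * ph0 - (tau * epm * ep0 + q * ep0 * phm + sigma * phm * ph0))).
  by rewrite /x1 /y1 /x0 /y0 /xm /ym; ring.
by rewrite Ea Eb Ec Ed Ee !subrr !mulr0 !addr0.
Qed.

(** For nonzero [sigma] the expression is [- (U + sigma * s * V)], and (a) one index higher reads
    [al n.+2 * U = be n.+2 * V]. If it vanished, so would [U], because a_{n+1}(s) is nonzero, and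
    then [V]. This forces [q = - (sigma * tau)]; (a) then propagates [al = be] from index 2 on,
    which contradicts [U = 0] outside the excluded case. *)
Lemma recurrence_nondegenerate (q sigma tau : R) (al be : nat -> R) :
  0 <= sigma -> (q, sigma * tau) <> (-1, 1) -> al 1%N = 0 -> be 1%N = 1 ->
  (forall n, (1 <= n)%N ->
    sigma ^+ 2 * tau * al n * al n.+1 + sigma * q * al n * be n.+1
      + sigma * be n * be n.+1 = sigma * al n.+1 * be n) ->
  (forall n t, 0 <= t -> sigma * al n.+1 * t + be n.+1 <> 0) ->
  forall n s, 0 < s ->
    sigma * al n.+1 * (tau - q * s) - be n.+1 * (1 + sigma * s) != 0.
Proof.
move=> sg0 hq al1 be1 eqa a0 n s s0; apply/eqP => D0.
(* For [sigma = 0] the expression is [- be n.+1], minus the value of a_n at time 0. *)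
have [sz|sn] := eqVneq sigma 0.
  apply: (a0 n 0) => //.
  by move: D0; rewrite sz !mul0r !add0r addr0 mulr1 => /eqP; rewrite oppr_eq0 => /eqP.
have sp : 0 < sigma by rewrite lt_neqAle eq_sym sn.
have eqa' k : al k.+2 * (be k.+1 - sigma * tau * al k.+1)
    = be k.+2 * (be k.+1 + q * al k.+1).
  by apply: (mulfI sn); have := eqa k.+1 isT; lra.
set U := be n.+1 - sigma * tau * al n.+1.
set V := be n.+1 + q * al n.+1.
have UV : U + sigma * s * V = 0 by rewrite /U /V; lra.
have U0 : U = 0.
  have : (sigma * al n.+2 * s + be n.+2) * U = 0.
    transitivity (be n.+2 * (U + sigma * s * V)); last by rewrite UV mulr0.
    transitivity (sigma * s * (al n.+2 * U) + be n.+2 * U); first by ring.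
    by rewrite eqa' -/V; ring.
  by move/eqP; rewrite mulf_eq0 => /orP[/eqP/(a0 _ _ (ltW s0))|/eqP].
have V0 : V = 0.
  move: UV; rewrite U0 add0r => /eqP; rewrite !mulf_eq0 (negPf sn).
  by rewrite (gt_eqF s0) => /eqP.
have aln : al n.+1 != 0.
  apply/eqP => az; apply: (a0 n 0) => //.
  by move: V0; rewrite /V az !mulr0 addr0 add0r.
have qE : q = - (sigma * tau).
  by apply: (mulIf aln); move: U0 V0; rewrite /U /V; lra.
have st1 : 1 - sigma * tau != 0.
  rewrite subr_eq0; apply/eqP => st; apply: hq.
  by rewrite qE -st.
have alE k : al k.+2 = be k.+2.
  elim: k => [|k IH]; first by have := eqa' 0%N; rewrite al1 be1; lra.
  have bk : be k.+2 != 0.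
    apply/eqP => bz; apply: (a0 k.+1 0) => //.
    by rewrite mulr0 add0r.
  apply: (mulIf (mulf_neq0 st1 bk)).
  by have := eqa' k.+1; rewrite IH qE; lra.
have bE : be n.+1 = sigma * tau * al n.+1 by move: U0; rewrite /U; lra.
clear U0 V0 UV D0 U V.
case: n aln bE => [|n] aln bE; first by rewrite al1 eqxx in aln.
by move/eqP: aln; apply; apply: (mulIf st1); move: bE; rewrite -alE; lra.
Qed.
End algebra.

(** * Conditional moments of the harness *)

Section harness.
Context (d : measure_display) (T : measurableType d) (R : realType)
        (P : probability T R) (X : R -> {RV P >-> R}).
Variables (q eta theta sigma tau : R).
Hypothesis hX : quadratic_harness X q eta theta sigma tau.
Hypothesis hmom : finite_moments X.

Local Notation pastfuture s u := ([set t | 0 < t <= s] `|` [set t | u <= t]).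

Lemma all_moments_process t : 0 < t -> all_moments P (X t).
Proof.
move=> t0; split; first exact: measurable_funP.
by move=> n; apply/Lfun1_integrable; exact: hmom.
Qed.

(** [condvar_eq] squares an arbitrary version of the conditional mean; uniqueness identifies it with
    the linear one of the harness. *)
Lemma condexp_version_ae_unique I (f g h : T -> R) :
  condexp_version P (sigma_process X I) f g ->
  condexp_version P (sigma_process X I) f h -> {ae P, forall w, g w = h w}.
Proof.
move=> [_ /Lfun1_integrable ig mg gavg] [_ /Lfun1_integrable ih mh havg].
have mgI : process_measurable X I g by move=> _ B mB; rewrite setTI; exact: mg.
have mhI : process_measurable X I h by move=> _ B mB; rewrite setTI; exact: mh.
have ik : P.-integrable setT (EFin \o (fun w => g w + -1 * h w)).
  by apply: integrable_EFinD => //; exact: integrable_EFinZ.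
have mk : process_measurable X I (fun w => g w + -1 * h w).
  by apply: measurable_funD => //; exact: measurable_funM.
have kE : {ae P, forall w, g w + -1 * h w = 0}.
  apply: (condexp_unique (@sigma_process_measurable _ _ _ _ X I) ik mk) => A GA.
  have mA := sigma_process_measurable GA.
  rewrite RintegralD//; [|exact: integrable_on|exact/integrable_on/integrable_EFinZ].
  rewrite RintegralZl//; last exact: integrable_on.
  by rewrite /Rintegral gavg// havg// mulN1r subrr.
by apply: filterS kE => w /eqP; rewrite mulN1r subr_eq0 => /eqP.
Qed.

Lemma harness_avg s t u : 0 < s -> s < t -> t < u ->
  avg_eq X (pastfuture s u) (X t)
    (fun w => (u - t) / (u - s) * X s w + (t - s) / (u - s) * X u w).
Proof.
move=> s0 st tu; apply: condexp_eq_avg; last exact: (qh_harness hX).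
by apply: measurable_funD; exact: measurable_funM.
Qed.

(** E[X_t^2 | F_{s,u}] at X_s = x and X_u = y: the prescribed conditional variance plus the square
    of the linear conditional mean. *)
Definition harness_quad s t u (x y : R) : R :=
  (u - t) * (t - s) / (u * (1 + sigma * s) + tau - q * s) *
    (1 + eta * ((u * x - s * y) / (u - s)) + theta * ((y - x) / (u - s))
     + sigma * ((u * x - s * y) / (u - s)) ^+ 2
     + tau * ((y - x) / (u - s)) ^+ 2
     - (1 - q) * ((y - x) / (u - s)) * ((u * x - s * y) / (u - s)))
  + ((u - t) / (u - s) * x + (t - s) / (u - s) * y) ^+ 2.

Lemma harness_avg_sqr s t u : 0 < s -> s < t -> t < u ->
  avg_eq X (pastfuture s u) (fun w => X t w ^+ 2)
    (fun w => harness_quad s t u (X s w) (X u w)).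
Proof.
move=> s0 st tu; apply: condexp_eq_avg.
  by rewrite /harness_quad; do ?[apply: measurable_funB|apply: measurable_funD|
     apply: measurable_funX|apply: measurable_funM].
have [h vh hE] := qh_harness hX s0 st tu.
have [m1 [m2 [v1 v2 mE]]] := qh_quadratic hX s0 st tu.
exists m2; first exact: v2.
have m1E := condexp_version_ae_unique v1 vh.
apply: filterS3 hE mE m1E => w /= hw mw m1w.
by rewrite /harness_quad -hw -m1w -mw /Delta /tDelta subrK.
Qed.

(* E |X_u - X_s|^2 = u - s, so the increment over (s, u], which the harness
   property makes proportional to u - s on average over any past event, has
   zero average. *)
Lemma process_martingale s t : 0 < s -> s < t ->
  avg_eq X [set r | 0 < r <= s] (X t) (X s).
Proof.
move=> s0 st A GA; have mA := sigma_process_measurable GA.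
have t0 : 0 < t by exact: lt_trans st.
pose L (f : T -> R) := \int[P]_(w in A) f w.
rewrite -/(L (X t)) -/(L (X s)).
have Lharness u : t < u -> L (X t) - L (X s) = (t - s) / (u - s) * (L (X u) - L (X s)).
  move=> tu; have su : s < u by exact: lt_trans tu.
  have u0 : 0 < u by exact: lt_trans su.
  have GA' : sigma_process X (pastfuture s u) A.
    by apply: sigma_process_sub GA => r; left.
  rewrite {1}/L (harness_avg s0 st tu GA').
  rewrite RintegralD_moments//; try by
    apply: all_momentsM; [exact: all_moments_cst|exact: all_moments_process].
  rewrite !RintegralZ_moments//; try exact: all_moments_process.
  by rewrite -/(L _) -/(L _); field; rewrite subr_eq0 gt_eqF.
(* At [u = s + r ^+ 2] the increment from [s] has second moment [r ^+ 2], so the AM-GM bound with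
   weight [r] against the constant 1 gives [r]; the factor [(t - s) / r ^+ 2] turns it into
   [(t - s) / r]. *)
have Lbound r : 0 < r -> t < s + r ^+ 2 ->
    `|L (X t) - L (X s)| <= (t - s) / r.
  move=> r0 tu; rewrite (Lharness _ tu) addrAC subrr add0r normrM.
  set u := s + r ^+ 2 in tu *.
  have su : s < u by exact: lt_trans tu.
  have u0 : 0 < u by exact: lt_trans su.
  have hu := all_moments_process u0; have hs := all_moments_process s0.
  have hns : all_moments P (fun w => -1 * X s w).
    by apply: all_momentsM => //; exact: all_moments_cst.
  have hus := all_momentsD hu hns.
  have LE : L (X u) - L (X s) = \int[P]_(w in A) ((X u w + -1 * X s w) * 1).
    under eq_Rintegral do rewrite mulr1.
    by rewrite RintegralD_moments// RintegralZ_moments// mulN1r.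
  have := Rintegral_prod_le mA hus (all_moments_cst P 1) r0.
  rewrite -LE.
  have cov v v' : 0 < v -> 0 < v' -> \int[P]_w (X v w * X v' w) = Num.min v v'.
    move=> v0 v'0; have := qh_cov hX v0 v'0.
    by rewrite unlock => /(congr1 fine).
  have -> : \int[P]_w ((X u w + -1 * X s w) ^+ 2) = r ^+ 2.
    rewrite (@eq_Rintegral _ _ _ P setT (fun w => X u w * X u w +
       (-2 * (X s w * X u w) + X s w * X s w))); last by move=> w _; ring.
    have h1 := all_momentsM hu hu; have h2 := all_momentsM hs hu.
    have h3 := all_momentsM hs hs.
    have h4 : all_moments P (fun w => -2 * (X s w * X u w)).
      by apply: all_momentsM => //; exact: all_moments_cst.
    rewrite RintegralD_moments//; last exact: all_momentsD.
    rewrite RintegralD_moments// RintegralZ_moments// !cov// !minxx.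
    by rewrite (min_idPl (ltW su)) /u; ring.
  under eq_Rintegral do rewrite expr1n.
  rewrite Rintegral_cst// mul1r.
  have -> : fine (P [set: T]) = 1 := congr1 fine (probability_setT P).
  rewrite mulr1.
  move=> h; rewrite -[leRHS]mulr1 -(@mulfV _ r) ?gt_eqF//.
  have -> : (t - s) / r * (r / r) = `|(t - s) / r ^+ 2| * r.
    by rewrite ger0_norm ?divr_ge0 ?sqr_ge0 ?subr_ge0 1?ltW//; field; rewrite gt_eqF.
  rewrite ler_wpM2l// (le_trans h)// expr2 mulfK ?gt_eqF//.
  by lra.
apply/eqP; rewrite -subr_eq0 -normr_eq0; apply/negPn/negP => n0.
have D0 : 0 < `|L (X t) - L (X s)| by rewrite lt_neqAle eq_sym n0 normr_ge0.
set D := `|_| in D0 Lbound.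
have ts0 : 0 < t - s by rewrite subr_gt0.
have q0 : 0 < (t - s) / D by rewrite divr_gt0.
(* [r] exceeds [(t - s) / D], so that the bound falls below [D], and [r ^+ 2] exceeds [t - s], as
   [Lbound] requires. *)
pose r := (t - s) / D + (t - s) + 1.
have r0 : 0 < r by rewrite /r; lra.
have tr : t < s + r ^+ 2.
  have sq (x y : R) : 0 < x -> 0 < y -> y < (x + y + 1) ^+ 2 by nra.
  by rewrite -ltrBlDl; exact: sq.
have := Lbound r r0 tr; apply/negP; rewrite -ltNge ltr_pdivrMr//.
have -> : D * r = (t - s) + (D * (t - s) + D) by rewrite /r; field; rewrite gt_eqF.
by rewrite ltrDl addr_gt0 ?mulr_gt0.
Qed.

End harness.

(** * The martingale property and orthogonality *)

Section martingale_polynomials.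
Context (d : measure_display) (T : measurableType d) (R : realType)
        (P : probability T R) (X : R -> {RV P >-> R}).
Variables (q eta theta sigma tau : R).
Hypothesis hX : quadratic_harness X q eta theta sigma tau.
Hypothesis hmom : finite_moments X.
Hypothesis hq : (q, sigma * tau) <> (-1, 1).
Variables (al be ga de ep ph : nat -> R).
Hypotheses (al1 : al 1%N = 0) (be1 : be 1%N = 1).
Hypotheses (ga0 : ga 0%N = 0) (de0 : de 0%N = 0).
Hypotheses (ep1 : ep 1%N = 1) (ph1 : ph 1%N = 0).
Hypothesis eqa : forall n : nat, (1 <= n)%N ->
    sigma ^+ 2 * tau * al n * al n.+1 + sigma * q * al n * be n.+1
      + sigma * be n * be n.+1
    = sigma * al n.+1 * be n.
Hypothesis eqb : forall n : nat,
    be n.+1 * ga n.+1 + sigma * al n.+1 * de n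
    = sigma * tau * al n.+1 * (ga n + ga n.+1)
      + q * (sigma * al n.+1 * de n.+1 + be n.+1 * ga n)
      + sigma * be n.+1 * (de n + de n.+1)
      + sigma * al n.+1 * theta + be n.+1 * eta.
Hypothesis eqc : forall n : nat, (1 <= n)%N ->
    be n.+1 * ep n.+1 + ga n * de n + sigma * al n * ph n
    = tau * (sigma * al n.+1 * ep n.+1 + ga n ^+ 2 + sigma * al n * ep n)
      + q * (sigma * al n.+1 * ph n.+1 + ga n * de n + be n * ep n)
      + sigma * (be n.+1 * ph n.+1 + de n ^+ 2 + be n * ph n)
      + ga n * theta + de n * eta + 1.
Hypothesis eqd : forall n : nat, (1 <= n)%N ->
    ga n.-1 * ph n + de n * ep n
    = tau * (ga n.-1 + ga n) * ep n
      + q * (ga n * ph n + de n.-1 * ep n)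
      + sigma * (de n.-1 + de n) * ph n
      + ep n * theta + ph n * eta.
Hypothesis eqe : forall n : nat, (1 <= n)%N ->
    ep n * ph n.+1
    = tau * ep n * ep n.+1 + q * ep n.+1 * ph n + sigma * ph n * ph n.+1.
Hypothesis a_neq0 : forall (n : nat) (t : R), 0 <= t ->
  sigma * al n.+1 * t + be n.+1 <> 0.
Variable p : nat -> R -> {poly R}.
Hypothesis p0 : forall t : R, 0 < t -> p 0%N t = 1.
Hypothesis p1 : forall t : R, 0 < t -> p 1%N t = 'X.

(* The lower off-diagonal of the Jacobi matrix, extended by 0 at index 0 so
   that the recurrence, (c), (d) and (e) hold there with n.-1 read as junk. *)
Let ep' n := if n is _.+1 then ep n else 0.
Let ph' n := if n is _.+1 then ph n else 0.
Let a n t := sigma * al n.+1 * t + be n.+1.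
Let b n t := ga n * t + de n.
Let c n t := ep' n * t + ph' n.

Hypothesis prec : forall (n : nat) (t : R), 0 < t ->
  'X * p n t = a n t *: p n.+1 t + b n t *: p n t + c n t *: p n.-1 t.

Let past s : set R := [set r | 0 < r <= s].
Let pv n t : T -> R := fun w => (p n t).[X t w].

(** * The recurrence and its equations, extended to index 0 *)

Lemma prec_horner n t x : 0 < t ->
  x * (p n t).[x] = a n t * (p n.+1 t).[x] + b n t * (p n t).[x]
    + c n t * (p n.-1 t).[x].
Proof.
by move=> /(prec n) /(congr1 (fun r => r.[x])); rewrite hornerM hornerX !hornerE.
Qed.

(** [n.-1.+1] is [n] except at 0, where [c] vanishes; rows of index [n.-1] can thus be used without
    separating [n = 0]. *)
Lemma c_a_pred n t v : c n v * a n.-1 t = c n v * (sigma * al n * t + be n).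
Proof. by case: n => [|n]; rewrite // /c !mul0r addr0 !mul0r. Qed.

(** Equation (c) is assumed from 1 on. At 0 the initial conditions reduce both sides to 1, and the
    zeros of [ep'] and [ph'] kill the unspecified [al 0] and [be 0]. *)
Lemma eqc_ext n :
    be n.+1 * ep n.+1 + ga n * de n + sigma * al n * ph' n
    = tau * (sigma * al n.+1 * ep n.+1 + ga n ^+ 2 + sigma * al n * ep' n)
      + q * (sigma * al n.+1 * ph n.+1 + ga n * de n + be n * ep' n)
      + sigma * (be n.+1 * ph n.+1 + de n ^+ 2 + be n * ph' n)
      + ga n * theta + de n * eta + 1.
Proof.
case: n => [|n]; last exact: eqc.
by rewrite /ep' /ph' al1 be1 ga0 de0 ep1 ph1; ring.
Qed.

Lemma eqd_ext n : ga n.-1 * ph' n + de n * ep' n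
    = tau * (ga n.-1 + ga n) * ep' n
      + q * (ga n * ph' n + de n.-1 * ep' n)
      + sigma * (de n.-1 + de n) * ph' n
      + ep' n * theta + ph' n * eta.
Proof. by case: n => [|n]; [rewrite /ep' /ph'; ring|exact: eqd]. Qed.

(** This is (e) shifted down by one; at 0 and 1 every term carries a zero of [ep'] or [ph']. *)
Lemma eqe_ext n : ep' n.-1 * ph' n
    = tau * ep' n.-1 * ep' n + q * ep' n * ph' n.-1 + sigma * ph' n.-1 * ph' n.
Proof.
by case: n => [|[|n]]; [rewrite /ep' /ph'; ring|rewrite /ep' /ph' /=; ring|exact: eqe].
Qed.

Lemma process_measurable_horner I t (r : {poly R}) : I t ->
  process_measurable X I (fun w => r.[X t w]).
Proof.
move=> It; rewrite /process_measurable.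
elim/poly_ind: r => [|r k IH].
  by under eq_fun do rewrite horner0; exact: measurable_cst.
under eq_fun do rewrite hornerMXaddC.
by apply: measurable_funD => //; apply: measurable_funM => //;
  exact: process_measurableX.
Qed.

Lemma all_moments_pv n t : 0 < t -> all_moments P (pv n t).
Proof. by move=> t0; apply/all_moments_horner/all_moments_process. Qed.

(** * The induction step of the martingale property *)

Definition martingale_poly n := forall s t, 0 < s -> s < t ->
  avg_eq X (past s) (pv n t) (pv n s).

Lemma martingale_poly_step N : (forall k, (k <= N.+1)%N -> martingale_poly k) ->
  martingale_poly N.+2.
Proof.
move=> mart s t s0 st A GA; have mA := sigma_process_measurable GA.
pose u := t + 1.
have tu : t < u by rewrite /u ltrDl.
have su : s < u by exact: lt_trans tu.
have t0 : 0 < t by exact: lt_trans st.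
have u0 : 0 < u by exact: lt_trans su.
have us0 : u - s != 0 by rewrite subr_eq0 gt_eqF.
have sg0 := qh_sigma hX; have tau0 := qh_tau hX.
have den0 : u * (1 + sigma * s) + tau - q * s != 0.
  rewrite gt_eqF//;
  apply: (harness_denominator_gt0 sg0 tau0 (sqrtr_ge0 _) _ (qh_q hX)) => //.
  by rewrite sqr_sqrtr// mulr_ge0.
pose L f := \int[P]_(w in A) f w.
have LD f g : all_moments P f -> all_moments P g ->
    L (fun w => f w + g w) = L f + L g by exact: RintegralD_moments.
have LZ r f : all_moments P f -> L (fun w => r * f w) = r * L f.
  exact: RintegralZ_moments.
have hXv v : 0 < v -> all_moments P (X v) by exact: all_moments_process.
have hp k v : 0 < v -> all_moments P (pv k v) by exact: all_moments_pv.
have hM f g := @all_momentsM _ _ _ P f g.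
have hZ r f : all_moments P f -> all_moments P (fun w => r * f w).
  by move=> hf; apply: all_momentsM => //; exact: all_moments_cst.
have hD f g := @all_momentsD _ _ _ P f g.
pose Lp Y k v := L (fun w => Y w * pv k v w).
have row k v Y Z : 0 < v -> all_moments P Y -> (forall w, Z w = Y w * X v w) ->
    Lp Z k v = a k v * Lp Y k.+1 v + b k v * Lp Y k v + c k v * Lp Y k.-1 v.
  move=> v0 hY ZE; rewrite /Lp -!LZ -?LD; try by
    do ?[apply: (hD)|apply: (hZ)|apply: (hM)|exact: hp|exact: hY].
  congr L; apply/funext => w; rewrite ZE -mulrA [X v w * _]prec_horner//.
  by rewrite /pv; ring.
have row_pred k v v' Y Z : 0 < v -> all_moments P Y ->
    (forall w, Z w = Y w * X v w) ->
    c k v' * Lp Z k.-1 v = c k v' * (a k.-1 v * Lp Y k v + b k.-1 v * Lp Y k.-1 v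
       + c k.-1 v * Lp Y k.-2 v).
  case: k => [|k] v0 hY ZE; first by rewrite /c !mul0r add0r !mul0r.
  by rewrite (row _ _ Y).
(* The induction hypothesis moves the time of p_k from [v'] back to [v] under any factor known at
   time [v]. *)
have freeze k v v' Y : (k <= N.+1)%N -> s <= v -> v < v' -> all_moments P Y ->
    process_measurable X (past v) Y -> Lp Y k v' = Lp Y k v.
  move=> kN sv vv' hY mY; have v0 : 0 < v by exact: lt_le_trans sv.
  have v'0 : 0 < v' by exact: lt_trans vv'.
  apply: (avg_eqM (hp k v' v'0) (hp k v v0) hY mY (mart k kN v v' v0 vv')).
  apply: sigma_process_sub GA => r; rewrite /past /= => /andP[-> rs] /=.
  exact: le_trans sv.
have GA' : sigma_process X ([set r | 0 < r <= s] `|` [set r | u <= r]) A.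
  by apply: sigma_process_sub GA => r; left.
have mpv k : process_measurable X ([set r | 0 < r <= s] `|` [set r | u <= r]) (pv k u).
  by apply: process_measurable_horner; right => /=.
have h1 := all_moments_cst P 1.
have mX v : 0 < v -> process_measurable X (past v) (X v).
  by move=> v0; apply: process_measurableX; rewrite /past /= v0 lexx.
have m1 v : process_measurable X (past v) (fun=> 1) by exact: measurable_cst.
have mXX v : 0 < v -> process_measurable X (past v) (fun w => X v w * X v w).
  by move=> v0; apply: measurable_funM; exact: mX.
pose m k := Lp (fun=> 1) k s.
have hXX v v' : 0 < v -> 0 < v' -> all_moments P (fun w => X v w * X v' w).
  by move=> v0 v'0; apply: (hM); exact: hXv.
have Lp1 k v : (k <= N.+1)%N -> s <= v -> Lp (fun=> 1) k v = m k.
  move=> kN; rewrite le_eqVlt => /orP[/eqP<-//|sv].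
  exact: freeze.
(* Up to index [N.+1] the averages [m k] are constant in time; only index [N.+2] may still depend on
   [v], and [W v - m N.+2] is the error to be killed. *)
pose W v := Lp (fun=> 1) N.+2 v.
have one_mul v w : X v w = 1 * X v w by rewrite mul1r.
have vpos v : s <= v -> 0 < v by exact: lt_le_trans.
have N0 : (N <= N.+1)%N by lia.
have N1 : (N.-1 <= N.+1)%N by lia.
have N2 : (N.-2 <= N.+1)%N by lia.
have r0 v : s <= v -> Lp (X v) N v = a N v * m N.+1 + b N v * m N + c N v * m N.-1.
  by move=> sv; have v0 := vpos v sv; rewrite (row N v (fun=> 1)) ?Lp1.
have r1 v : s <= v -> Lp (X v) N.+1 v =
    a N.+1 v * W v + b N.+1 v * m N.+1 + c N.+1 v * m N.
  by move=> sv; have v0 := vpos v sv; rewrite (row N.+1 v (fun=> 1)) ?(Lp1 N.+1) ?(Lp1 N).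
have rm v v' : s <= v -> c N v' * Lp (X v) N.-1 v =
    c N v' * (a N.-1 v * m N + b N.-1 v * m N.-1 + c N.-1 v * m N.-2).
  by move=> sv; have v0 := vpos v sv; rewrite (row_pred N v v' (fun=> 1)) ?Lp1.
have r2 v : s <= v -> Lp (fun w => X v w * X v w) N v =
    a N v * Lp (X v) N.+1 v + b N v * Lp (X v) N v + c N v * Lp (X v) N.-1 v.
  move=> sv; have v0 : 0 < v by exact: lt_le_trans sv.
  by rewrite (row N v (X v)) //; exact: hXv.
(* The harness identity is multiplied by p_{N+1}(X_u;u), which is known in the future; [freeze] then
   brings this factor back to [t] next to [X t] and to [s] next to [X s]. *)
have harness1 : Lp (X t) N.+1 t = (u - t) / (u - s) * Lp (X s) N.+1 s
    + (t - s) / (u - s) * Lp (X u) N.+1 u.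
  rewrite -(freeze N.+1 t u) ?(ltW st)//; [|exact: hXv|exact: mX].
  rewrite -(freeze N.+1 s u) //; [|exact: hXv|exact: mX].
  have hXsu : all_moments P
      (fun w => (u - t) / (u - s) * X s w + (t - s) / (u - s) * X u w).
    by apply: (hD); apply: (hZ); exact: hXv.
  have := avg_eqM (hXv _ t0) hXsu (hp N.+1 u u0) (mpv _) (harness_avg hX s0 st tu) GA'.
  rewrite /Lp -!LZ -?LD; try by
    do ?[apply: (hD)|apply: (hZ)|apply: (hM)|exact: hp|exact: hXv].
  rewrite -/(L _) -/(L _) => E.
  transitivity (L (fun w => pv N.+1 u w * X t w)).
    by congr L; apply/funext => w; rewrite mulrC.
  by rewrite E; congr L; apply/funext => w; ring.
(* The same device with p_N(X_u;u) and the conditional second moment, in the form that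
   [quadratic_harness_closure] expects. *)
have harness2 :
  let Jss := Lp (fun w => X s w * X s w) N s in
  let Jsu := Lp (fun w => X s w * X u w) N u in
  let Juu := Lp (fun w => X u w * X u w) N u in
  let Js := Lp (X s) N s in let Ju := Lp (X u) N u in
  let k := (u - t) / (u - s) in let l := (t - s) / (u - s) in
  Lp (fun w => X t w * X t w) N t =
  (u - t) * (t - s) / (u * (1 + sigma * s) + tau - q * s) *
    (m N + eta * ((u * Js - s * Ju) / (u - s)) + theta * ((Ju - Js) / (u - s))
     + sigma * ((u ^+ 2 * Jss - 2 * (u * s) * Jsu + s ^+ 2 * Juu) / (u - s) ^+ 2)
     + tau * ((Juu - 2 * Jsu + Jss) / (u - s) ^+ 2)
     - (1 - q) * (((u + s) * Jsu - s * Juu - u * Jss) / (u - s) ^+ 2))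
  + (k ^+ 2 * Jss + 2 * (k * l) * Jsu + l ^+ 2 * Juu).
  rewrite -(freeze N t u) ?(ltW st)//; [|exact: hXX|exact: mXX].
  rewrite -(freeze N s u) //; [|exact: hXX|exact: mXX].
  rewrite -(freeze N s u) //; [|exact: hXv|exact: mX].
  rewrite -(Lp1 N u N0 (ltW su)) => Jss Jsu Juu Js Ju k l.
  (* [c1] to [c5] are the coefficients of x^2, xy, y^2, x, y in [harness_quad], and [K] is its
     constant term: a flat sum to which [L] applies term by term. *)
  pose K := (u - t) * (t - s) / (u * (1 + sigma * s) + tau - q * s).
  pose c1 := K * (sigma * u ^+ 2 + tau + (1 - q) * u) / (u - s) ^+ 2 + k ^+ 2.
  pose c2 := - K * (2 * (sigma * (u * s)) + 2 * tau + (1 - q) * (u + s))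
    / (u - s) ^+ 2 + 2 * (k * l).
  pose c3 := K * (sigma * s ^+ 2 + tau + (1 - q) * s) / (u - s) ^+ 2 + l ^+ 2.
  pose c4 := K * (eta * u - theta) / (u - s).
  pose c5 := K * (theta - eta * s) / (u - s).
  have quadE x y : harness_quad q eta theta sigma tau s t u x y =
      c1 * (x * x) + (c2 * (x * y) + (c3 * (y * y) + (c4 * x + (c5 * y + K * 1)))).
    rewrite /harness_quad /c1 /c2 /c3 /c4 /c5 /K /k /l; field.
    by rewrite us0 den0.
  have hXt2 : all_moments P (fun w => X t w ^+ 2).
    by under eq_fun do rewrite expr2; exact: hXX.
  have hquad : all_moments P
      (fun w => harness_quad q eta theta sigma tau s t u (X s w) (X u w)).
    under eq_fun do rewrite quadE.
    by do ?[exact: hXX|exact: hXv|exact: h1|apply: (hD)|apply: (hZ)].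
  have := avg_eqM hXt2 hquad (hp N u u0) (mpv _) (harness_avg_sqr hX s0 st tu) GA'.
  rewrite -/(L _) -/(L _) => E.
  transitivity (L (fun w => pv N u w * X t w ^+ 2)).
    by congr L; apply/funext => w; rewrite mulrC.
  have -> : K * (Lp (fun=> 1) N u + eta * ((u * Js - s * Ju) / (u - s))
     + theta * ((Ju - Js) / (u - s))
     + sigma * ((u ^+ 2 * Jss - 2 * (u * s) * Jsu + s ^+ 2 * Juu) / (u - s) ^+ 2)
     + tau * ((Juu - 2 * Jsu + Jss) / (u - s) ^+ 2)
     - (1 - q) * (((u + s) * Jsu - s * Juu - u * Jss) / (u - s) ^+ 2))
    + (k ^+ 2 * Jss + 2 * (k * l) * Jsu + l ^+ 2 * Juu)
    = c1 * Jss + (c2 * Jsu + (c3 * Juu + (c4 * Js + (c5 * Ju + K * Lp (fun=> 1) N u)))).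
    by rewrite /c1 /c2 /c3 /c4 /c5; field.
  rewrite E /Jss /Jsu /Juu /Js /Ju /Lp -!LZ -?LD; try by
    do ?[exact: hp|exact: hXv|exact: h1|apply: (hD)|apply: (hZ)|apply: (hM)].
  by congr L; apply/funext => w; rewrite quadE; ring.
(* After expansion at time [u] the remaining factor [X s] allows freezing at [s], so the mixed
   moment carries no error. *)
have r2su : Lp (fun w => X s w * X u w) N u =
    a N u * Lp (X s) N.+1 s + b N u * Lp (X s) N s + c N u * Lp (X s) N.-1 s.
  rewrite (row N u (X s)) //; last exact: hXv.
  by rewrite !(freeze _ s u)//; first [exact: hXv|exact: mX].
have Ws : W s = m N.+2 by [].
pose et := a N.+1 t * (W t - m N.+2).
pose eu := a N.+1 u * (W u - m N.+2).
suff et0 : et = 0.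
  rewrite -[LHS]/(L (fun w => pv N.+2 t w)).
  have -> : L (fun w => pv N.+2 t w) = W t.
    by congr L; apply/funext => w; rewrite mul1r.
  have -> : \int[P]_(w in A) pv N.+2 s w = m N.+2.
    by congr L; apply/funext => w; rewrite mul1r.
  move/eqP: et0; rewrite mulf_eq0 subr_eq0 => /orP[/eqP h|/eqP//].
  by case: (a_neq0 _ h); exact: ltW.
(* Rows N+1, N and N-1 of x and y applied to the vector [m]: [v * x1 + y1] is the predicted average
   of X_v p_{N+1}(X_v;v), and likewise for the lower rows. *)
pose x1 := sigma * al N.+2 * m N.+2 + ga N.+1 * m N.+1 + ep' N.+1 * m N.
pose y1 := be N.+2 * m N.+2 + de N.+1 * m N.+1 + ph' N.+1 * m N.
pose x0 := sigma * al N.+1 * m N.+1 + ga N * m N + ep' N * m N.-1.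
pose y0 := be N.+1 * m N.+1 + de N * m N + ph' N * m N.-1.
pose xm := sigma * al N * m N + ga N.-1 * m N.-1 + ep' N.-1 * m N.-2.
pose ym := be N * m N + de N.-1 * m N.-1 + ph' N.-1 * m N.-2.
have comm := qcommutation_row (m N) (m N.+1) (m N.+2) (m N.-1) (m N.-2)
  (@eqa N.+1 isT) (eqb N) (eqc_ext N) (eqd_ext N) (eqe_ext N).
rewrite /= -/x1 -/y1 -/x0 -/y0 -/xm -/ym in comm.
have nondeg := recurrence_nondegenerate sg0 hq al1 be1 eqa a_neq0 N s0.
have r1E v : s <= v -> Lp (X v) N.+1 v = v * x1 + y1 + a N.+1 v * (W v - m N.+2).
  by move=> sv; rewrite r1// /x1 /y1 /a /b /c; ring.
have r0E v : s <= v -> Lp (X v) N v = v * x0 + y0.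
  by move=> sv; rewrite r0// /x0 /y0 /a /b /c; ring.
have rmE v v' : s <= v -> c N v' * Lp (X v) N.-1 v = c N v' * (v * xm + ym).
  move=> sv; rewrite rm// /xm /ym -addrA mulrDr mulrA c_a_pred /b /c; ring.
pose XX := sigma * al N.+1 * x1 + ga N * x0 + ep' N * xm.
pose XY := be N.+1 * x1 + de N * x0 + ph' N * xm.
pose YX := sigma * al N.+1 * y1 + ga N * y0 + ep' N * ym.
pose YY := be N.+1 * y1 + de N * y0 + ph' N * ym.
have r2E v : s <= v -> Lp (fun w => X v w * X v w) N v =
    v ^+ 2 * XX + v * (XY + YX) + YY
    + (sigma * al N.+1 * v + be N.+1) * (a N.+1 v * (W v - m N.+2)).
  move=> sv; rewrite r2// r1E// r0E// rmE// {1}/a /b /c /XX /XY /YX /YY; ring.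
have r2suE : Lp (fun w => X s w * X u w) N u =
    s * u * XX + s * XY + u * YX + YY.
  rewrite r2su r1E// r0E// rmE// Ws subrr mulr0 addr0 {1}/a /b /c /XX /XY /YX /YY; ring.
have tu0 : t - u != 0 by rewrite subr_eq0 lt_eqF.
have ts0 : t - s != 0 by rewrite subr_eq0 gt_eqF.
(* The predicted value [v * x1 + y1] is affine in [v], so interpolation between [s] and [u]
   reproduces it and only the errors remain, the one at [s] being zero. *)
have Eet : et = (t - s) / (u - s) * eu.
  have := harness1.
  rewrite (r1E t (ltW st)) (r1E s (lexx s)) (r1E u (ltW su)) Ws subrr mulr0 addr0 -/et -/eu => E.
  by apply: (addrI (t * x1 + y1)); rewrite E; field.
apply: (quadratic_harness_closure us0 tu0 ts0 den0 nondeg comm Eet).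
move: harness2.
rewrite /= r2suE (r2E t (ltW st)) (r2E s (lexx s)) (r2E u (ltW su)).
rewrite (r0E s (lexx s)) (r0E u (ltW su)) Ws subrr !mulr0 addr0 -/et -/eu.
by rewrite /XX /XY /YX /YY.
Qed.
(** When the recurrence is solved for p_{n+1}, which is possible as a_n is nonzero, ['X * p n t] is
    its only term of degree n+1. *)
Lemma size_martingale_poly n t : 0 < t -> size (p n t) = n.+1.
Proof.
move=> t0; have [n_eq _] : size (p n t) = n.+1 /\ (size (p n.-1 t) <= n.+1)%N;
  last by [].
elim: n => [|n [IH IH']]; first by rewrite p0// size_poly1.
split; last by rewrite IH.
have an0 : a n t != 0 by apply/eqP; apply: a_neq0; exact: ltW.
have E : a n t *: p n.+1 t
    = 'X * p n t - (b n t *: p n t + c n t *: p n.-1 t).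
  by rewrite prec// -[X in X - _]addrA addrK.
rewrite -(size_scale _ an0) E.
have pn0 : p n t != 0 by rewrite -size_poly_eq0 IH.
have sX : size ('X * p n t) = n.+2 by rewrite mulrC size_mulX// IH.
rewrite size_polyDl ?sX// size_polyN ltnS (leq_trans (size_polyD _ _))//.
by rewrite geq_max !(leq_trans (size_scale_leq _ _))// IH.
Qed.

Lemma martingale_poly_all n : martingale_poly n.
Proof.
elim/ltn_ind: n => -[_|[_|n IH]].
- move=> s t s0 st A _; rewrite /pv !p0//; last exact: lt_trans st.
  under eq_Rintegral do rewrite hornerE.
  by under [RHS]eq_Rintegral do rewrite hornerE.
- move=> s t s0 st A GA; rewrite /pv !p1//; last exact: lt_trans st.
  under eq_Rintegral do rewrite hornerX.
  under [RHS]eq_Rintegral do rewrite hornerX.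
  exact: (process_martingale hX hmom s0 st GA).
- by apply: martingale_poly_step => k kn; apply: IH; rewrite ltnS.
Qed.

(** * Expectations of the polynomials and orthogonality to lower degrees *)

Lemma expectation_row n t Y Z : 0 < t -> all_moments P Y ->
  (forall w, Z w = Y w * X t w) ->
  \int[P]_w (Z w * pv n t w) = a n t * \int[P]_w (Y w * pv n.+1 t w)
    + b n t * \int[P]_w (Y w * pv n t w) + c n t * \int[P]_w (Y w * pv n.-1 t w).
Proof.
move=> t0 hY ZE.
have hYp k : all_moments P (fun w => Y w * pv k t w).
  by apply: all_momentsM => //; exact: all_moments_pv.
have hZ r k : all_moments P (fun w => r * (Y w * pv k t w)).
  by apply: all_momentsM => //; exact: all_moments_cst.
rewrite -!RintegralZ_moments// -!RintegralD_moments//; last exact: all_momentsD.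
apply: eq_Rintegral => w _; rewrite ZE -mulrA [X t w * _]prec_horner//.
by rewrite /pv; ring.
Qed.

Lemma expectation_martingale_poly n s t Y : 0 < s -> s < t -> all_moments P Y ->
  process_measurable X (past s) Y ->
  \int[P]_w (Y w * pv n t w) = \int[P]_w (Y w * pv n s w).
Proof.
move=> s0 st hY mY.
have := avg_eqM (all_moments_pv n (lt_trans s0 st)) (all_moments_pv n s0) hY mY
  (@martingale_poly_all n s t s0 st).
by apply; exact: (@measurableT _ (g_sigma_algebraType (process_gen X (past s)))).
Qed.

Lemma expectation_martingale_poly_cst n s t : 0 < s -> 0 < t ->
  \int[P]_w pv n t w = \int[P]_w pv n s w.
Proof.
have h1 := all_moments_cst P 1.
have E r k : \int[P]_w pv r k w = \int[P]_w (1 * pv r k w).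
  by under [RHS]eq_Rintegral do rewrite mul1r.
move=> s0 t0; rewrite !E; have [st|ts|->//] := ltgtP s t.
- by apply: expectation_martingale_poly => //; exact: measurable_cst.
- by apply/esym/expectation_martingale_poly => //; exact: measurable_cst.
Qed.

(* With e_n = E p_n(X_t;t), which does not depend on t, the recurrence makes
   E[X_t p_n(X_u;u)] = E[X_t p_n(X_t;t)] affine in t with value
   beta_{n+1} e_{n+1} at t = 0, where it vanishes by Cauchy-Schwarz. *)
Lemma expectation_martingale_poly0 n t : 0 < t -> \int[P]_w pv n.+1 t w = 0.
Proof.
have h1 := all_moments_cst P 1.
have E1 k v : \int[P]_w pv k v w = \int[P]_w (1 * pv k v w).
  by under [RHS]eq_Rintegral do rewrite mul1r.
elim/ltn_ind: n t => -[_|n IH] t t0.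
  rewrite /pv p1//; under eq_Rintegral do rewrite hornerX.
  by have := qh_mean hX t0; rewrite unlock => /(congr1 fine).
rewrite (@expectation_martingale_poly_cst _ 1)//.
set e := \int[P]_w _.
(* By induction p_n has mean zero for [n > 0], giving [kap = 0]; for [n = 0] the mean is 1 and
   c_1(v) = v, giving [kap = 1]. *)
have [kap kapE] : exists kap, forall v, 0 < v ->
    c n.+1 v * \int[P]_w pv n v w = v * kap.
  case: n @e IH => [|n] e IH; last by exists 0 => v v0; rewrite IH// !mulr0.
  exists 1 => v v0; rewrite /c /= ep1 ph1 /pv p0// mul1r addr0.
  under eq_Rintegral do rewrite hornerE.
  rewrite Rintegral_cst// !mul1r; congr (_ * _).
  have P1 : fine (P [set: T]) = 1 := congr1 fine (probability_setT P).
  exact: P1.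
pose Q := pv n.+1 1; have hQ : all_moments P Q by exact: all_moments_pv.
pose C := \int[P]_w (Q w ^+ 2).
have C0 : 0 <= C by apply: Rintegral_ge0 => w _; exact: sqr_ge0.
pose h := sigma * al n.+2 * e + kap.
(* At time [r ^+ 2] the process has second moment [r ^+ 2], so AM-GM with weight [r] against [Q]
   gives the factor [r]; [r < 1] makes this time precede the time 1 of [Q]. *)
have key r : 0 < r -> r < 1 -> `|h * r ^+ 2 + be n.+2 * e| <= r * ((1 + C) / 2).
  move=> r0 r1; have v0 : 0 < r ^+ 2 by exact: exprn_gt0.
  have v1 : r ^+ 2 < 1 by rewrite expr_lt1// ltW.
  have hv := all_moments_process hmom v0.
  have mv : process_measurable X (past (r ^+ 2)) (X (r ^+ 2)).
    by apply: process_measurableX; rewrite /past /= v0 lexx.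
  have := Rintegral_prod_le (@measurableT _ T) hv hQ r0.
  rewrite (@expectation_martingale_poly _ (r ^+ 2))//.
  rewrite (@expectation_row _ _ (fun=> 1))//; last by move=> w; rewrite mul1r.
  rewrite -!E1 /= kapE// (@expectation_martingale_poly_cst n.+2 1)// -/e.
  rewrite IH// mulr0 addr0 -/C.
  have -> : \int[P]_w (X (r ^+ 2) w ^+ 2) = r ^+ 2.
    under eq_Rintegral do rewrite expr2.
    have := qh_cov hX v0 v0; rewrite unlock => /(congr1 fine).
    by rewrite minxx.
  have -> : a n.+1 (r ^+ 2) * e + r ^+ 2 * kap = h * r ^+ 2 + be n.+2 * e.
    by rewrite /h /a; ring.
  by rewrite (_ : _ / 2 = r * ((1 + C) / 2))//; field; rewrite gt_eqF.
have be0 : be n.+2 != 0.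
  by apply/eqP => bz; apply: (a_neq0 (n := n.+1) (lexx 0)); rewrite mulr0 add0r.
suff : be n.+2 * e = 0 by move/eqP; rewrite mulf_eq0 (negPf be0) => /eqP.
apply/eqP; rewrite -normr_eq0; apply/negPn/negP => D0.
set D := `|_| in D0.
have Dp : 0 < D by rewrite lt_neqAle eq_sym D0 normr_ge0.
pose M := (1 + C) / 2 + `|h|.
have Mp : 0 < M by rewrite /M ltr_pwDl// divr_gt0// ltr_pwDl.
(* Chosen so that [r < 1] and [r * M < D], against the bound [D <= r * M] that [key] yields. *)
pose r := D / (M + D).
have MD : 0 < M + D by exact: addr_gt0.
have r0 : 0 < r by rewrite divr_gt0.
have r1 : r < 1 by rewrite ltr_pdivrMr// mul1r ltrDr.
have : D <= r * M.
  have -> : D = `|(h * r ^+ 2 + be n.+2 * e) - h * r ^+ 2| by rewrite addrAC subrr add0r.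
  rewrite (le_trans (ler_normB _ _))// /M mulrDr lerD ?key//.
  rewrite normrM mulrC (ger0_norm (sqr_ge0 r)) ler_wpM2r// expr2.
  by rewrite ger_pMr// ltW.
rewrite leNgt => /negP; apply.
by rewrite /r mulrAC ltr_pdivrMr// ltr_pM2l// ltrDl.
Qed.

(** Horner induction on [Q]: the recurrence passes the factor [X t] to polynomials of neighbouring
    index, which still bounds the size of the smaller [Q], while the constant term meets a
    polynomial of mean zero. *)
Lemma orthogonal_lower_degree (Q : {poly R}) n t : 0 < t -> (size Q <= n)%N ->
  \int[P]_w (Q.[X t w] * pv n t w) = 0.
Proof.
move=> t0; have hp k := all_moments_pv k t0.
have hXt := all_moments_process hmom t0.
elim/poly_ind: Q n => [|Q k IH] n.
  move=> _; under eq_Rintegral do rewrite horner0 mul0r.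
  by rewrite Rintegral_cst// mul0r.
have hQ := all_moments_horner Q hXt.
rewrite size_MXaddC; case: ifP => [/andP[/eqP-> /eqP->] _|_].
  under eq_Rintegral do rewrite mul0r add0r hornerC mul0r.
  by rewrite Rintegral_cst// mul0r.
case: n => // n; rewrite ltnS => Qn.
under eq_Rintegral do rewrite hornerMXaddC mulrDl.
rewrite RintegralD_moments//; last 2 first.
- by apply: all_momentsM => //; exact: all_momentsM.
- by apply: all_momentsM => //; exact: all_moments_cst.
rewrite RintegralZ_moments// expectation_martingale_poly0// mulr0 addr0.
rewrite (@expectation_row _ _ (fun w => Q.[X t w]))//.
rewrite !IH ?mulr0 ?addr0//.
all: by rewrite ?(leq_trans Qn)// ltnW.
Qed.

End martingale_polynomials.

Theorem theorem2p4 (d : measure_display) (T : measurableType d) (R : realType)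
  (P : probability T R) (X : R -> {RV P >-> R}) (q eta theta sigma tau : R)
  (hX : quadratic_harness X q eta theta sigma tau)
  (hmom : finite_moments X)
  (hq : (q, sigma * tau) <> (-1, 1))
  (al be ga de ep ph : nat -> R)
  (al1 : al 1%N = 0) (be1 : be 1%N = 1) (ga0 : ga 0%N = 0) (de0 : de 0%N = 0)
  (ep1 : ep 1%N = 1) (ph1 : ph 1%N = 0)
  (eqa : forall n : nat, (1 <= n)%N ->
    sigma ^+ 2 * tau * al n * al n.+1 + sigma * q * al n * be n.+1
      + sigma * be n * be n.+1
    = sigma * al n.+1 * be n)
  (eqb : forall n : nat,
    be n.+1 * ga n.+1 + sigma * al n.+1 * de n
    = sigma * tau * al n.+1 * (ga n + ga n.+1)
      + q * (sigma * al n.+1 * de n.+1 + be n.+1 * ga n)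
      + sigma * be n.+1 * (de n + de n.+1)
      + sigma * al n.+1 * theta + be n.+1 * eta)
  (eqc : forall n : nat, (1 <= n)%N ->
    be n.+1 * ep n.+1 + ga n * de n + sigma * al n * ph n
    = tau * (sigma * al n.+1 * ep n.+1 + ga n ^+ 2 + sigma * al n * ep n)
      + q * (sigma * al n.+1 * ph n.+1 + ga n * de n + be n * ep n)
      + sigma * (be n.+1 * ph n.+1 + de n ^+ 2 + be n * ph n)
      + ga n * theta + de n * eta + 1)
  (eqd : forall n : nat, (1 <= n)%N ->
    ga n.-1 * ph n + de n * ep n
    = tau * (ga n.-1 + ga n) * ep n
      + q * (ga n * ph n + de n.-1 * ep n)
      + sigma * (de n.-1 + de n) * ph n
      + ep n * theta + ph n * eta)
  (eqe : forall n : nat, (1 <= n)%N ->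
    ep n * ph n.+1
    = tau * ep n * ep n.+1 + q * ep n.+1 * ph n + sigma * ph n * ph n.+1)
  (a b c : nat -> R -> R)
  (ha : forall (n : nat) (t : R), a n t = sigma * al n.+1 * t + be n.+1)
  (hb : forall (n : nat) (t : R), b n t = ga n * t + de n)
  (hc : forall (n : nat) (t : R), (1 <= n)%N -> c n t = ep n * t + ph n)
  (a_neq0 : forall (n : nat) (t : R), 0 <= t -> a n t <> 0)
  (p : nat -> R -> {poly R})
  (p0 : forall t : R, 0 < t -> p 0%N t = 1)
  (p1 : forall t : R, 0 < t -> p 1%N t = 'X)
  (prec : forall (n : nat) (t : R), 0 < t ->
    'X * p n t = a n t *: p n.+1 t + b n t *: p n t
      + (if n is m.+1 then c n t *: p m t else 0)) :
  orthogonal_martingale_polynomials X p.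
Proof.
(* Coefficients extended by 0 at index 0 absorb the absent p_{-1} term, so one recurrence holds for
   all [n], with [p n.-1] multiplied by 0 at [n = 0]. *)
pose ep' n := if n is _.+1 then ep n else 0.
pose ph' n := if n is _.+1 then ph n else 0.
have a_neq0' n t : 0 <= t -> sigma * al n.+1 * t + be n.+1 <> 0.
  by rewrite -ha; exact: a_neq0.
have prec' n t : 0 < t -> 'X * p n t = (sigma * al n.+1 * t + be n.+1) *: p n.+1 t
    + (ga n * t + de n) *: p n t + (ep' n * t + ph' n) *: p n.-1 t.
  move=> t0; rewrite prec// ha hb; congr (_ + _).
  case: n => [|n]; last by rewrite hc.
  by rewrite /ep' /ph' mul0r addr0 scale0r.
have size_p n t : 0 < t -> size (p n t) = n.+1.
  exact: (size_martingale_poly a_neq0' p0 prec').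
have hpoly n t : 0 < t -> all_moments P (fun w => (p n t).[X t w]).
  by move=> t0; apply/all_moments_horner/all_moments_process.
have orth n m t : 0 < t -> (n < m)%N ->
    \int[P]_w ((p n t).[X t w] * (p m t).[X t w]) = 0.
  move=> t0 nm.
  apply: (orthogonal_lower_degree hX hmom hq al1 be1 ga0 de0 ep1 ph1 eqa eqb eqc
    eqd eqe a_neq0' p0 p1 prec') => //.
  by rewrite size_p.
split; first by [].
- move=> n s t s0 st; apply: (avg_condexp_eq (I := [set r | 0 < r <= s])).
  + exact: hpoly (lt_trans s0 st).
  + exact: hpoly.
  + by apply: process_measurable_horner; rewrite /= s0 lexx.
  + exact: (martingale_poly_all hX hmom hq al1 be1 ga0 de0 ep1 ph1 eqa eqb eqc
      eqd eqe a_neq0' p0 p1 prec').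
- move=> n m t t0 nm; rewrite unlock -[LHS]fineK; last first.
    by apply: integrable_fin_num => //; apply: all_moments_integrable;
       apply: all_momentsM; exact: hpoly.
  congr EFin; move/eqP: nm; rewrite neq_ltn => /orP[nm|mn].
    exact: orth.
  rewrite -(orth m n t)//; congr fine; apply: eq_integral => w _.
  by rewrite mulrC.
Qed.
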